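(* If $N,n,r,s$ are positive integers with $n\ge 3$ and $r>s$ such that $R_2(n;r,s)>N$, then $R_3(n+1;2r,s)>2^N$.
   Context: For positive integers $n,k,r,s$ with $n>k$ and $r>s$, an $(r,s)$-coloring of the complete $k$-uniform hypergraph $K_N^{(k)}$ is a map $\chi:E(K_N^{(k)})\to\binom{[r]}{s}$. A monochromatic $n$-clique is a set of $n$ vertices such that all $\binom{n}{k}$ edges within it contain a common color. $R_k(n;r,s)$ is the minimum $N$ such that every $(r,s)$-coloring of $K_N^{(k)}$ contains a monochromatic $n$-clique. *)

(* Defs.v *)
From mathcomp Require Import all_boot.

Set Implicit Arguments.
Unset Strict Implicit.
Unset Printing Implicit Defensive.

(* The k-element subsets of an m-element ground set: the edges of the complete
   k-uniform hypergraph on m vertices, and also the set [m] choose k. *)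
Definition ksubset (m k : nat) := {e : {set 'I_m} | #|e| == k}.

Definition coloring (N k r s : nat) := {ffun ksubset N k -> ksubset r s}.

Definition mono_clique (N k n r s : nat) (chi : coloring N k r s)
    (S : {set 'I_N}) : bool :=
  (#|S| == n) &&
  [exists c : 'I_r, [forall e : ksubset N k,
    (val e \subset S) ==> (c \in val (chi e))]].

Definition ramsey_prop (k n r s N : nat) : bool :=
  [forall chi : coloring N k r s, [exists S, mono_clique n chi S]].

(* Ramsey's theorem, in the form required by an induction on k and then on the
   sum of the target sizes m c; it makes the minimum below well defined. *)
Lemma ramsey_targets (k r t : nat) :
  exists N, forall (T : finType) (A : {set T}) (f : {set T} -> {set 'I_r})
      (m : 'I_r -> nat),
    (forall e : {set T}, e \subset A -> #|e| = k -> f e != set0) ->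
    \sum_c m c <= t -> N <= #|A| ->
    exists c, exists S : {set T}, [/\ S \subset A, #|S| = m c &
      forall e : {set T}, e \subset S -> #|e| = k -> c \in f e].
Proof.
have sub (T : finType) (A : {set T}) n : n <= #|A| ->
    exists2 S : {set T}, S \subset A & #|S| = n.
  move=> /card_geqP[s [us <- sA]]; exists [set x in s].
    by apply/subsetP => x; rewrite inE => /sA.
  by rewrite cardsE; apply/card_uniqP.
elim: k t => [|k IHk] t.
  exists t => T A f m f0 mt tA.
  have /set0Pn[c cf] := f0 set0 (sub0set _) (cards0 _).
  have mcA : m c <= #|A|.
    by apply: leq_trans tA; apply: leq_trans mt; rewrite (bigD1 c) //= leq_addr.
  have [S SA Sc] := sub T A (m c) mcA.
  by exists c, S; split=> // e _ /eqP; rewrite cards_eq0 => /eqP ->.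
elim: t => [|t [N IHt]].
  exists k.+1 => T A f m f0 m0 kA.
  have [e eA ek] := sub T A k.+1 kA.
  have /set0Pn[c _] := f0 e eA ek.
  exists c, set0; split; rewrite ?sub0set //.
    by move: m0; rewrite cards0 (bigD1 c) //= leqn0 addn_eq0 => /andP[/eqP ->].
  by move=> e'; rewrite subset0 => /eqP ->; rewrite cards0.
have [M HM] := IHk (r * N); exists M.+1 => T A f m f0 mt MA.
have [/existsP[c /eqP mc0]|/existsPn m0] := boolP [exists c, m c == 0].
  exists c, set0; split; rewrite ?sub0set ?cards0 //.
  by move=> e'; rewrite subset0 => /eqP ->; rewrite cards0.
have /card_gt0P[x xA] : 0 < #|A| by apply: leq_trans MA.
have cA : #|A| = #|A :\ x|.+1 by rewrite (cardsD1 x A) xA.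
have cx (e : {set T}) : e \subset A :\ x -> #|x |: e| = #|e|.+1.
  by rewrite subsetD1 cardsU1 => /andP[_ ->].
case: (HM T (A :\ x) (fun e => f (x |: e)) (fun=> N)).
- move=> e eA ek; apply: f0; last by rewrite cx ?ek.
  by rewrite subUset sub1set xA (subset_trans eA) // subD1set.
- by rewrite sum_nat_const card_ord.
- by rewrite -ltnS -cA.
move=> c [S [SA SN Sf]].
have SA' : S \subset A := subset_trans SA (subD1set _ _).
case: (IHt T S f (fun d => m d - (d == c))); last 1 first.
- move=> d [S' [S'S S'm S'f]].
  have [dc|dc] := eqVneq d c; last first.
    exists d, S'; split=> //; first exact: subset_trans SA'.
    by rewrite S'm (negPf dc) subn0.
  subst d; exists c, (x |: S'); split.
  + by rewrite subUset sub1set xA (subset_trans S'S).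
  + rewrite cx ?(subset_trans S'S) // S'm eqxx subn1 prednK // lt0n.
    exact: m0.
  move=> e eS ek; have [xe|xe] := boolP (x \in e).
    rewrite -(setD1K xe); apply: Sf.
      by apply: subset_trans S'S; rewrite subDset.
    by apply/eqP; rewrite -eqSS -ek (cardsD1 x e) xe.
  apply: S'f => //; apply/subsetP => y ye.
  have := subsetP eS y ye; rewrite !inE => /orP[/eqP yx|//].
  by rewrite -yx ye in xe.
- by move=> e eS; apply: f0; apply: subset_trans SA'.
- rewrite -ltnS; apply: leq_trans mt.
  rewrite (bigD1 c) //= [X in _ < X](bigD1 c) //= eqxx.
  rewrite -addSn subn1 prednK ?lt0n ?m0 // leq_add2l.
  by apply: leq_sum => i _; rewrite leq_subr.
- by rewrite SN.
Qed.

Lemma ramsey_exists (k n r s : nat) : 0 < s -> exists N, ramsey_prop k n r s N.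
Proof.
move=> s0; have [N HN] := ramsey_targets k r (r * n); exists N.
apply/forallP => chi.
pose f (e : {set 'I_N}) : {set 'I_r} :=
  if insub e : option (ksubset N k) is Some e' then val (chi e') else set0.
have fE (e : ksubset N k) : f (val e) = val (chi e) by rewrite /f valK.
case: (HN _ [set: 'I_N] f (fun=> n)).
- move=> e _ /eqP ek; have /= -> := fE (Sub e ek).
  by rewrite -card_gt0 (eqP (valP (chi _))).
- by rewrite sum_nat_const card_ord.
- by rewrite cardsT card_ord.
move=> c [S [_ Sn Sf]]; apply/existsP; exists S.
rewrite /mono_clique Sn eqxx; apply/existsP; exists c.
apply/forallP => e; apply/implyP => eS.
by rewrite -fE; apply: Sf => //; apply/eqP; exact: (valP e).
Qed.

(* R_k(n; r, s); the minimum exists for every k, n, r once s is positive. *)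
Definition ramsey_number (k n r s : nat) (hs : 0 < s) : nat :=
  ex_minn (ramsey_exists k n r hs).
Arguments ramsey_number k n r s hs : clear implicits.

(* Main.v *)
Require Import Defs.
From mathcomp Require Import all_boot.
From mathcomp Require Import zify.

(* The stepping-up construction of Erdos and Hajnal.  Let [h x y] be one plus
   the position of the highest binary digit where [x] and [y] differ.  For
   [x < y < z] one has [h x y <> h y z] and [h x z = max (h x y) (h y z)].
   Color the triple [x < y < z] of numbers below [2 ^ N] by the colors of the
   pair [{h x y, h y z}], in one of two disjoint copies according to whether
   [h x y < h y z].  In a monochromatic clique [x_0 < ... < x_n] the numbers
   [h x_i x_{i+1}] are then strictly monotone, so each pair of them occurs as
   the pair attached to some triple, and they form a monochromatic n-clique. *)

Lemma high_bit_subproof (x y : nat) : exists j, x %/ 2 ^ j == y %/ 2 ^ j.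
Proof.
have lt2 z t : z <= t -> z < 2 ^ t by move=> zt; apply: leq_ltn_trans (ltn_expl t _).
by exists (x + y); rewrite !divn_small ?lt2 ?leq_addr ?leq_addl.
Qed.

(** Dividing by [2 ^ j] drops the lowest [j] binary digits, so the least [j] with equal quotients is
    the [h] above, and it is 0 when [x = y]. *)
Definition high_bit (x y : nat) : nat := ex_minn (high_bit_subproof x y).

Lemma high_bit_leq (x y j : nat) :
  (high_bit x y <= j) = (x %/ 2 ^ j == y %/ 2 ^ j).
Proof.
rewrite /high_bit; case: ex_minnP => m /eqP xym minm; apply/idP/idP => [mj|/minm //].
by rewrite -(subnKC mj) expnD !divnMA xym.
Qed.

Lemma high_bit_gt0 (x y : nat) : x < y -> 0 < high_bit x y.
Proof. by move=> xy; rewrite ltnNge high_bit_leq !divn1; lia. Qed.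

Lemma high_bit_bounded (N x y : nat) :
  x < 2 ^ N -> y < 2 ^ N -> high_bit x y <= N.
Proof. by move=> xN yN; rewrite high_bit_leq !divn_small. Qed.

(** Division by [2 ^ j] is monotone, so the outer quotients agree exactly when both neighboring ones
    do. *)
Lemma high_bit_max (x y z : nat) : x <= y -> y <= z ->
  high_bit x z = maxn (high_bit x y) (high_bit y z).
Proof.
move=> xy yz.
have E j : (high_bit x z <= j) = (maxn (high_bit x y) (high_bit y z) <= j).
  rewrite geq_max !high_bit_leq.
  have := leq_div2r (2 ^ j) xy; have := leq_div2r (2 ^ j) yz; lia.
by apply/eqP; rewrite eqn_leq E leqnn -E leqnn.
Qed.

(** If both were [j.+1], the quotients by [2 ^ j] would be three distinct numbers with the same
    half. *)
Lemma high_bit_neq (x y z : nat) : x < y -> y < z ->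
  high_bit x y != high_bit y z.
Proof.
move=> xy yz; apply/eqP => E.
have := high_bit_gt0 x y xy; case def_j: (high_bit x y) => [//|j] _.
have := high_bit_leq x y j; have := high_bit_leq y z j.
have := high_bit_leq x y j.+1; have := high_bit_leq y z j.+1.
rewrite -E def_j leqnn ltnn expnSr !divnMA.
have := leq_div2r (2 ^ j) (ltnW xy); have := leq_div2r (2 ^ j) (ltnW yz); lia.
Qed.

Lemma monotone_high_bits (n : nat) (x : nat -> nat) (b : bool)
    (P : nat -> nat -> Prop) :
  (forall i j, i < j -> j <= n -> x i < x j) ->
  (forall i j k, i < j -> j < k -> k <= n ->
    (high_bit (x i) (x j) < high_bit (x j) (x k)) = b /\
    P (high_bit (x i) (x j)) (high_bit (x j) (x k))) ->
  forall i j, i < j -> j < n ->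
    high_bit (x i) (x i.+1) != high_bit (x j) (x j.+1) /\
    P (high_bit (x i) (x i.+1)) (high_bit (x j) (x j.+1)).
Proof.
move=> xlt H i j ij jn.
have split3 p q t : p < q -> q < t -> t <= n ->
    high_bit (x p) (x t) = maxn (high_bit (x p) (x q)) (high_bit (x q) (x t)).
  by move=> pq qt tn; apply: high_bit_max; apply: ltnW; apply: xlt => //; lia.
have neq3 p q t : p < q -> q < t -> t <= n ->
    high_bit (x p) (x q) != high_bit (x q) (x t).
  by move=> pq qt tn; apply: high_bit_neq; apply: xlt => //; lia.
case: b H => H.
(* In the increasing case the maximum over an interval sits at its last gap, so the triple
   [i, i.+1, j.+1] carries the desired pair. *)
- have last_bit p q : p < q -> q < n -> high_bit (x p) (x q.+1) = high_bit (x q) (x q.+1).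
    move=> pq qn; have [+ _] := H p q q.+1 pq (ltnSn q) qn.
    by rewrite (split3 p q q.+1) //; lia.
  have [->|ne] := eqVneq j i.+1.
    by split; [apply: neq3; lia | apply H; lia].
  by rewrite -(last_bit i.+1 j); [split; [apply: neq3; lia | apply H; lia] | lia | lia].
(* In the decreasing case it sits at the first gap, and the triple [i, j, j.+1] serves. *)
have first_bit p q : p < q -> q <= n -> high_bit (x p) (x q) = high_bit (x p) (x p.+1).
  move=> pq qn; have [->//|ne] := eqVneq q p.+1.
  have [+ _] := H p p.+1 q (ltnSn p) ltac:(lia) qn.
  by rewrite (split3 p p.+1 q) //; lia.
by rewrite -(first_bit i j) //; [split; [apply: neq3; lia | apply H; lia] | lia].
Qed.

Definition elements (m : nat) (e : {set 'I_m}) : seq nat :=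
  [seq val i | i <- enum e].

Lemma sorted_elements (m : nat) (e : {set 'I_m}) : sorted ltn (elements m e).
Proof.
apply: (subseq_sorted ltn_trans _ (iota_ltn_sorted 0 m)).
rewrite -val_enum_ord; apply: map_subseq.
by rewrite {1}/enum_mem -enumT filter_subseq.
Qed.

Lemma elements_set3 (m : nat) (i j k : 'I_m) : i < j -> j < k ->
  elements m [set i; j; k] = [:: val i; val j; val k].
Proof.
move=> ij jk.
apply: (irr_sorted_eq ltn_trans ltnn); first exact: sorted_elements.
  by rewrite /= ij jk.
move=> y; apply/mapP/idP => [[u + ->]|].
  by rewrite mem_enum !inE -!val_eqE orbA.
by rewrite !inE => /or3P[] /eqP ->; [exists i|exists j|exists k];
  rewrite // mem_enum !inE eqxx ?orbT.
Qed.

(* The default [D] is returned off the edges, so that every value has s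
   elements. *)
Definition edge_colors (N k r s : nat) (D : ksubset r s) (chi : coloring N k r s)
    (e : {set 'I_N}) : ksubset r s :=
  if insub e : option (ksubset N k) is Some e' then chi e' else D.

Lemma edge_colorsE (N k r s : nat) (D : ksubset r s) (chi : coloring N k r s)
    (e : ksubset N k) : edge_colors N k r s D chi (val e) = chi e.
Proof. by rewrite /edge_colors valK. Qed.

(** Places the two disjoint copies of the palette inside [2 * r] colors; the Boolean names the
    copy. *)
Lemma double_ord_inj (r : nat) : exists g : bool * 'I_r -> 'I_(2 * r), injective g.
Proof.
have E : #|{: bool * 'I_r}| = 2 * r by rewrite card_prod card_bool card_ord.
exists (fun u => cast_ord E (enum_rank u)) => u v.
by move=> /cast_ord_inj /enum_rank_inj.
Qed.

Lemma step_up (N n r s m : nat) : s <= r -> 2 <= n -> m <= 2 ^ N.+1 ->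
  ramsey_prop 3 n.+1 (2 * r) s m -> ramsey_prop 2 n r s N.+1.
Proof.
move=> sr n2 mN /forallP R; apply/forallP => chi.
have [D0 D0s] : exists A : {set 'I_r}, #|A| == s.
  have : 0 < #|[set A : {set 'I_r} | #|A| == s]|.
    by rewrite card_draws card_ord bin_gt0.
  by case/card_gt0P=> A; rewrite inE; exists A.
pose D : ksubset r s := Sub D0 D0s.
have [g g_inj] := double_ord_inj r.
(* For distinct numbers below [2 ^ N.+1] the high bit lies between 1 and [N.+1]; the predecessor
   shifts it to a vertex. *)
pose bit x y : 'I_N.+1 := inord (high_bit x y).-1.
pose F x y z : {set 'I_(2 * r)} :=
  [set g (high_bit x y < high_bit y z, c)
    | c in val (edge_colors N.+1 2 r s D chi [set bit x y; bit y z])].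
have Fs x y z : #|F x y z| == s.
  rewrite card_imset; first by case: (edge_colors _ _ _ _ _ _ _).
  by move=> c c' /g_inj[].
pose psi : coloring m 3 (2 * r) s := [ffun e =>
  let t := elements m (val e) in
  Sub (F (nth 0 t 0) (nth 0 t 1) (nth 0 t 2)) (Fs _ _ _)].
have /existsP[S /andP[/eqP Sn /existsP[k /forallP Sk]]] := R psi.
pose x i := nth 0 (elements m S) i.
have xsize : size (elements m S) = n.+1 by rewrite size_map -cardE.
have xlt i j : i < j -> j <= n -> x i < x j.
  move=> ij jn; apply: (sorted_ltn_nth ltn_trans 0 (sorted_elements m S)) => //;
  by rewrite inE xsize; lia.
have xS i : i <= n -> exists2 u : 'I_m, u \in S & x i = val u.
  move=> iN; have /mapP[u uS ->] : x i \in elements m S by rewrite mem_nth // xsize.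
  by exists u => //; rewrite -mem_enum.
have kF i j t : i < j -> j < t -> t <= n -> k \in F (x i) (x j) (x t).
  move=> ij jt tn.
  have [u uS eu] := xS i ltac:(lia).
  have [v vS ev] := xS j ltac:(lia).
  have [w wS ew] := xS t tn.
  have uv : u < v by have := xlt i j ij ltac:(lia); rewrite eu ev.
  have vw : v < w by have := xlt j t jt tn; rewrite ev ew.
  have e3 : #|[set u; v; w]| == 3.
    by rewrite cardE -(size_map val) -/(elements _ _) elements_set3.
  have := Sk (Sub [set u; v; w] e3); rewrite /= ffunE /= elements_set3 //= eu ev ew.
  by move/implyP; apply; rewrite !subUset !sub1set uS vS.
(* The common color [k] fixes one copy [b], hence one direction of monotonicity, and one original
   color [c]. *)
have [[b c] gk] : exists u, k = g u.
  by have /imsetP[c _ ->] := kF 0 1 2 isT isT n2; eexists.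
pose P p q := c \in val (edge_colors N.+1 2 r s D chi [set inord p.-1; inord q.-1]).
have H := monotone_high_bits n x b P xlt.
have {}H : forall i j, i < j -> j < n ->
    high_bit (x i) (x i.+1) != high_bit (x j) (x j.+1) /\
    P (high_bit (x i) (x i.+1)) (high_bit (x j) (x j.+1)).
  apply: H => i j t ij jt tn.
  by have := kF i j t ij jt tn; rewrite gk => /imsetP[c' c'P /g_inj[-> cc]]; rewrite /P cc.
pose d (i : 'I_n) := bit (x i) (x i.+1).
have xN i : i <= n -> x i < 2 ^ N.+1.
  by move=> /xS[u _ ->]; exact: leq_trans (ltn_ord u) mN.
have d_val (i : 'I_n) : (d i).+1 = high_bit (x i) (x i.+1).
  have iN := ltn_ord i.
  have h0 := high_bit_gt0 _ _ (xlt i i.+1 (ltnSn i) iN).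
  have hN := high_bit_bounded _ _ _ (xN i (ltnW iN)) (xN i.+1 iN).
  by rewrite /d /bit inordK ?prednK.
have d_lt (i j : 'I_n) : i < j -> d i != d j.
  move=> ij; have [+ _] := H i j ij (ltn_ord j).
  by rewrite -!d_val eqSS val_eqE.
have d_inj : injective d.
  move=> i j dij; apply/val_inj/eqP; case: ltngtP => // ij.
    by have := d_lt i j ij; rewrite dij eqxx.
  by have := d_lt j i ij; rewrite dij eqxx.
have d_col (i j : 'I_n) : i != j ->
    c \in val (edge_colors N.+1 2 r s D chi [set d i; d j]).
  rewrite -val_eqE neq_ltn => /orP[ij|ji]; first exact: (H i j ij (ltn_ord j)).2.
  by rewrite setUC; exact: (H j i ji (ltn_ord i)).2.
(* The clique for [chi] consists of the [n] distinct bits between consecutive vertices of [S]. *)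
apply/existsP; exists (d @: setT).
rewrite /mono_clique card_imset // cardsT card_ord eqxx /=.
apply/existsP; exists c; apply/forallP => e; apply/implyP => eS.
have /cards2P[u [v [uv euv]]] := valP e.
have [/imsetP[i _ ui] /imsetP[j _ vj]] : u \in d @: setT /\ v \in d @: setT.
  by split; apply: (subsetP eS); rewrite euv !inE eqxx ?orbT.
rewrite -(edge_colorsE _ _ _ _ D) euv ui vj; apply: d_col.
by apply: contraNneq uv => ij; rewrite ui vj ij.
Qed.

Theorem theorem5p2 (N n r s : nat) (hN : 0 < N) (hn : 3 <= n) (hs : 0 < s)
    (hrs : s < r) :
  N < ramsey_number 2 n r s hs ->
  2 ^ N < ramsey_number 3 n.+1 (2 * r) s hs.
Proof.
case: N hN => // N _; rewrite /ramsey_number.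
case: ex_minnP => p _ pmin; case: ex_minnP => m Rm _.
(* By contraposition: if [m] is at most [2 ^ N.+1], stepping up gives the pair property at [N.+1],
   which bounds the minimum [p]. *)
rewrite !ltnNge; apply: contra => mN; apply: pmin.
exact: (step_up N n r s m (ltnW hrs) (ltnW hn) mN Rm).
Qed.
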